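(* For nonnegative integers $n$ and $k$, $|\mathcal{T}_{n,k}|=|\mathcal{F}_{n,k}|$; that is, $$\sum_{m=k}^n \binom{n+1}{m+1} S(m+1,k+1)\, k!\, (n-k)^{n-m-1} (m-k) = \sum_{i=0}^k (-1)^{i}\binom{k}{i}(n-i)^n,$$ where $S(a,b)$ denotes the Stirling number of the second kind.
   Context: $\mathcal{T}_n$ is the set of rooted labeled trees on vertex set $[0,n]=\{0,\dots,n\}$. For $T\in\mathcal{T}_n$, $\mathrm{MD}(T)$ (maximal decreasing subtree) is the subtree induced by the root and all vertices $v$ such that labels strictly decrease along the path from the root to $v$. $\mathcal{T}_{n,k}$ is the set of $T\in\mathcal{T}_n$ with $\mathrm{MD}(T)$ having exactly $k+1$ vertices. $[n]=\{1,\dots,n\}$ ($[0]=\emptyset$); $\mathcal{F}_{n,k}$ is the set of functions $f:[n]\to[n]$ with $[k]\subseteq f([n])$. Convention $0^0=1$; in the left-hand sum the factor $(n-k)^{n-m-1}(m-k)$ is interpreted as $1$ when $m=n$. *)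

(* Defs.v *)
From mathcomp Require Import all_boot all_order all_algebra.
Set Implicit Arguments.
Unset Strict Implicit.
Unset Printing Implicit Defensive.

(* A simple graph on V is given by its edge set, a set of 2-element sets. *)
Definition simple_graph (V : finType) (E : {set {set V}}) : bool :=
  [forall A in E, #|A| == 2].

Definition adj (V : finType) (E : {set {set V}}) : rel V :=
  fun u v => [set u; v] \in E.

Definition connected (V : finType) (E : {set {set V}}) : bool :=
  [forall u, forall v, connect (adj E) u v].

(* The bound on k loses nothing: a duplicate-free sequence over V has size
   at most #|V|.  A sequence [:: u; v] with u, v adjacent satisfies ucycleb,
   but is an edge run back and forth, not a cycle of the graph. *)
Definition acyclic (V : finType) (E : {set {set V}}) : bool :=
  [forall k : 'I_(#|V|.+1), forall c : k.-tuple V,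
     ucycleb (adj E) c ==> (k <= 2)].

Definition tree (V : finType) (E : {set {set V}}) : bool :=
  [&& simple_graph E, connected E & acyclic E].

(* A rooted tree is a pair (root, edge set); all roots are allowed. *)
Definition rooted_trees (n : nat) :
    {set 'I_n.+1 * {set {set 'I_n.+1}}} :=
  [set T | tree T.2].

(* The vertex set of MD(T).  The sequence root :: p is a simple path from the
   root to v (there is exactly one when T is a tree); it has at most n edges. *)
Definition MD (n : nat) (T : 'I_n.+1 * {set {set 'I_n.+1}}) :
    {set 'I_n.+1} :=
  [set v | [exists l : 'I_n.+1, exists p : l.-tuple 'I_n.+1,
     [&& path (adj T.2) T.1 p, uniq (T.1 :: p), last T.1 p == v
       & sorted (fun x y : 'I_n.+1 => y < x) (T.1 :: p)]]].

Definition trees_MD (n k : nat) : {set 'I_n.+1 * {set {set 'I_n.+1}}} :=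
  [set T in rooted_trees n | #|MD T| == k.+1].

(* The element i of 'I_n stands for the element i + 1 of [n] = {1, ..., n}.
   The inclusion of [k] in the image is tested in nat, so that it fails
   when n < k. *)
Definition funs_onto (n k : nat) : {set {ffun 'I_n -> 'I_n}} :=
  [set f : {ffun 'I_n -> 'I_n} |
     all (mem [seq (f x).+1 | x : 'I_n]) (iota 1 k)].

Definition stirling2 (a b : nat) : nat :=
  #|[set P : {set {set 'I_a}} | partition P [set: 'I_a] & #|P| == b]|.

(* Main.v *)
(* A rooted tree is encoded by its root and its parent function f.  A vertex lies
   in MD(T) iff its chain of iterated parents is increasing.  Fix the vertex set M
   of MD(T), with k+1 elements, and the set R of the vertices outside M whose
   parent is in M.  A tree then amounts to independent choices: a larger parent in
   M for each non-maximal element of M (k! choices in all), a smaller parent in M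
   for each element of R, and a forest with root set R on the complement of M.
   Sending each element of B = M u R to itself or to its smaller parent in M is
   the same as partitioning B into blocks with set of minima M, hence the factor
   S(m+1,k+1) with |B| = m+1.  Forests are counted by induction on their levels.

   For the identity, let D be the forward difference operator.  Inclusion-exclusion
   gives |F_{n,k}| = D^k[y^n](n-k), and likewise k! S(m+1,k+1) = D^k[y^m](1).  With
   N = n-k, the binomial theorem turns N times the left-hand sum into
   (n+1) D^k[y^n](N+1) - D^{k+1}[y^{n+1}](N), which the Leibniz rule for
   y * y^n simplifies to N D^k[y^n](N). *)
Require Import Defs.
From mathcomp Require Import all_boot all_order all_algebra.
From mathcomp Require Import ring zify.
Set Implicit Arguments.
Unset Strict Implicit.
Unset Printing Implicit Defensive.

(** * Partitions into the fibres of a function *)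

Lemma eq_preim_partition (T : finType) (X Y : eqType) (f : T -> X) (g : T -> Y)
    (D : {set T}) :
  {in D &, forall x y, (f x == f y) = (g x == g y)} ->
  preim_partition f D = preim_partition g D.
Proof.
move=> fg; apply: eq_in_imset => x xD.
by apply/setP => y; rewrite !inE; case: (boolP (y \in D)) => //= yD; rewrite fg.
Qed.

Lemma mem_pblock_preim (T : finType) (X : eqType) (f : T -> X) (D : {set T}) :
  {in D &, forall x y, (y \in pblock (preim_partition f D) x) = (f x == f y)}.
Proof.
apply: pblock_equivalence_partition => x y z _ _ _; split=> //.
by move=> /eqP ->.
Qed.

Lemma card_preim_partition (T Y : finType) (f : T -> Y) (D : {set T}) :
  #|preim_partition f D| = #|f @: D|.
Proof.
have -> : preim_partition f D
    = [set [set x in D | y == f x] | y in f @: D].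
  by rewrite -imset_comp.
rewrite card_in_imset // => _ _ /imsetP[x xD ->] /imsetP[y yD ->] /setP/(_ x).
by rewrite !inE xD eqxx => /esym/eqP.
Qed.

(** Assigning distinct values to the blocks of [P] yields exactly the functions with kernel [P], so
    the count is that of injections of [P] into [X]. *)
Lemma card_preim_partition_eq (T X : finType) (P : {set {set T}}) :
  partition P [set: T] ->
  #|[set g : {ffun T -> X} | preim_partition g [set: T] == P]| = (#|X| ^_ #|P|)%N.
Proof.
move=> partP; have [/eqP covP trivP P0] := and3P partP.
have blkP v : pblock P v \in P by rewrite pblock_mem // covP inE.
pose blk v : {A | A \in P} := exist _ (pblock P v) (blkP v).
have [wit witK] : exists wit, cancel wit blk.
  suff blk_onto A : exists v, blk v == A.
    by exists (fun A => xchoose (blk_onto A)) => A; apply/eqP/(xchooseP (blk_onto A)).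
  case: A => A AP; have /set0Pn[v vA] : A != set0 by apply: contraNneq P0 => <-.
  by exists v; rewrite -val_eqE /=; apply/eqP/def_pblock.
have <- : #|{: {A | A \in P}}| = #|P| by rewrite card_sig; apply: eq_card.
rewrite -card_inj_ffuns.
rewrite -[RHS](card_imset _ (f := fun t : {ffun _ -> X} => [ffun v => t (blk v)])).
  apply: eq_card => g; rewrite inE; apply/eqP/imsetP => [gP|[t]].
    exists [ffun A => g (wit A)].
      rewrite inE; apply/injectiveP => A B; rewrite !ffunE.
      move=> guv; rewrite -(witK A) -(witK B); apply/val_inj => /=.
      apply: same_pblock => //.
      by rewrite -gP mem_pblock_preim ?inE // guv.
    apply/ffunP => v; rewrite !ffunE; apply/eqP.
    rewrite -(@mem_pblock_preim _ _ g setT) ?inE // gP.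
    have := mem_pblock P (wit (blk v)).
    by rewrite covP inE (congr1 val (witK (blk v)) : pblock P _ = _).
  rewrite inE => /injectiveP injt ->; rewrite -[RHS](preim_partition_pblock partP).
  apply: eq_preim_partition => x y _ _; rewrite !ffunE (inj_eq injt).
  by rewrite -val_eqE.
move=> t t' /ffunP tt'; apply/ffunP => A.
by rewrite -(witK A); have := tt' (wit A); rewrite !ffunE.
Qed.

(** * Product counts, sums over subsets and forest numbers *)

Lemma card_family_prod (T Y : finType) (F : T -> {set Y}) :
  #|[set f : {ffun T -> Y} | f \in family F]| = \prod_x #|F x|.
Proof. by rewrite cardsE card_family foldrE big_map big_enum. Qed.

Lemma sum_subsets_card (T : finType) (A : {set T}) (g : nat -> nat) :
  \sum_(B : {set T} | B \subset A) g #|B| = \sum_(s < #|A|.+1) 'C(#|A|, s) * g s.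
Proof.
rewrite (partition_big (fun B : {set T} => inord #|B| : 'I_#|A|.+1) xpredT) //=.
apply: eq_bigr => s _; rewrite -cards_draws -sum_nat_const.
have cE (B : {set T}) : B \subset A -> (inord #|B| == s) = (#|B| == s).
  by move=> BA; rewrite -val_eqE /= inordK // ltnS subset_leq_card.
apply: eq_big => [B|B /andP[BA]]; last by rewrite cE // => /eqP ->.
by rewrite inE; case: (boolP (B \subset A)) => //= BA; rewrite cE.
Qed.

(* The number of rooted forests on [w] vertices with a given set of [s] roots;
   for [s = w] the general expression would be the junk value [w * w ^ 0]. *)
Definition nb_forests (w s : nat) : nat :=
  if s == w then 1 else s * w ^ (w - s - 1).

(** Since s C(w, s) = w C(w - 1, s - 1), the term of index s > 0 is C(w - 1, s - 1) r^s w^(w - s),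
    and the sum is r times a binomial expansion. *)
Lemma sum_nb_forests (r w : nat) : 0 < w ->
  \sum_(s < w.+1) 'C(w, s) * (r ^ s * nb_forests w s) = r * (r + w) ^ w.-1.
Proof.
case: w => // p _; rewrite big_ord_recl {1}/nb_forests /= !muln0 add0n addnC.
rewrite expnDn big_distrr /=; apply: eq_bigr => t _.
rewrite /bump /= add1n /nb_forests eqSS; case: eqVneq => [->|ne].
  by rewrite !binn subnn expn0 !muln1 !mul1n expnS.
have tp : t < p by have := ltn_ord t; lia.
have -> : p - t = (p.+1 - t.+1 - 1).+1 by lia.
have : p.+1 * 'C(p, t) = t.+1 * 'C(p.+1, t.+1) by rewrite (mul_bin_diag p.+1).
move=> E; rewrite !expnS; set X := _ ^ (p.+1 - _ - 1).
transitivity (t.+1 * 'C(p.+1, t.+1) * (r * r ^ t * X)); first by ring.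
by rewrite -E; ring.
Qed.

Lemma nb_forests_setD (T : finType) (B W : {set T}) : B \subset W ->
  (if W :\: B == set0 then 1 else #|W :\: (W :\: B)| * #|W| ^ #|W :\: B|.-1)
  = nb_forests #|W| #|B|.
Proof.
move=> BW; rewrite setDDr setDv set0U (setIidPr BW) /nb_forests -cards_eq0.
rewrite cardsD (setIidPr BW) subn_eq0.
have -> : (#|W| <= #|B|) = (#|B| == #|W|) by rewrite eqn_leq (subset_leq_card BW).
by rewrite subn1.
Qed.

(** * Functions without cycles in a set, and the count of forests *)

Section Escapes.
Variable V : finType.
Implicit Types (f : V -> V) (U W : {set V}).

(* Equivalently, [f] has no cycle inside [W]. *)
Definition escapes f W : bool :=
  [forall v in W, [exists x in ~: W, fconnect f v x]].

Lemma escapesP f W :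
  reflect {in W, forall v, exists i, iter i f v \notin W} (escapes f W).
Proof.
apply: (iffP forall_inP) => fW v /fW.
  by case/exists_inP => x; rewrite inE => xW /iter_findex E; exists (findex f v x); rewrite E.
by case=> i iW; apply/exists_inP; exists (iter i f v); rewrite ?inE ?fconnect_iter.
Qed.

(** The removed elements leave [W] in one step, so an orbit that leaves the smaller set is outside
    [W] at once or one step later. *)
Lemma escapes_step f W : escapes f W = escapes f (W :\: [set v in W | f v \notin W]).
Proof.
set S := [set v in W | f v \notin W].
apply/escapesP/escapesP => fW v.
  by case/setDP => /fW[i iW] _; exists i; apply: contra iW => /setDP[].
move=> vW; case: (boolP (v \in S)) => [|vS]; first by rewrite inE vW; exists 1.
have /fW vE : v \in W :\: S by rewrite inE vS.
case: (ex_minnP vE) => -[|i] nS min; first by rewrite /= in_setD vS vW in nS.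
have : iter i f v \in W :\: S by apply: contraT => /min; rewrite ltnn.
rewrite !inE => /andP[nyS yW]; rewrite yW /= negbK in nyS.
by exists i.+2; move: nS; rewrite /= !inE nyS andbT negbK => /andP[].
Qed.

(** Induction by levels: [B] collects the elements of [W] sent out of [W], each with [#|U :\: W|]
    choices. The rest of [W] maps into [W] and must escape [W :\: B], the same problem with [W] in
    place of [U]. The sum over [B] is [sum_nb_forests]. *)
Lemma card_escapes U W (F : V -> {set V}) :
  W \subset U -> {in W, forall v, F v = U} ->
  #|[set f in family F | escapes f W]|
  = (\prod_(v | v \notin W) #|F v|) *
    (if W == set0 then 1 else #|U :\: W| * #|U| ^ #|W|.-1).
Proof.
move: {2}#|W|.+1 (ltnSn #|W|) => m; elim: m => // m IH in U W F *.
rewrite ltnS => Wm WU FW.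
have [W0|W0] := eqVneq W set0.
  rewrite muln1 (eq_bigl xpredT); last by move=> v; rewrite W0 inE.
  rewrite -card_family_prod; apply: eq_card => f; rewrite !inE andb_idr // => _.
  by apply/escapesP => v; rewrite W0 inE.
have cW : 0 < #|W| by rewrite card_gt0.
pose S (f : {ffun V -> V}) := [set v in W | f v \notin W].
have -> : #|U| = #|U :\: W| + #|W| by rewrite -(cardsID W U) (setIidPr WU) addnC.
rewrite -sum_nb_forests // -(sum_subsets_card _ (fun s => _ ^ s * nb_forests _ s)).
rewrite -sum1_card (partition_big S (fun B => B \subset W)); last first.
  by move=> f _; apply/subsetP => v; rewrite inE => /andP[].
rewrite big_distrr /=; apply: eq_bigr => B BW; rewrite sum1dep_card.
have cB : #|W :\: B| = #|W| - #|B| by rewrite cardsD (setIidPr BW).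
(* With [B] empty no orbit leaves the nonempty [W], and [nb_forests] is 0 there. *)
have [B0|B0] := eqVneq B set0.
  rewrite B0 /nb_forests cards0 eq_sym (gtn_eqF cW) !muln0.
  apply/eqP; rewrite cards_eq0; apply/eqP/setP => f; rewrite !inE.
  apply/negP => /andP[/andP[_ /escapesP fW] /eqP Sf].
  have /set0Pn[v vW] := W0; have [i] := fW v vW; apply/negP; rewrite negbK.
  elim: i => //= i IHi; apply: contraT => nW.
  by have := in_set0 (iter i f v); rewrite -Sf inE IHi nW.
(* Values allowed once [B] is prescribed; constant on [W :\: B], as the induction hypothesis
   requires. *)
pose F' v := if v \in B then U :\: W else if v \in W then W else F v.
have cB0 : 0 < #|B| by rewrite card_gt0.
transitivity #|[set f in family F' | escapes f (W :\: B)]|.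
  apply: eq_card => f; rewrite !inE -andbA.
  apply/and3P/andP => [[/familyP fF fW /eqP SB]|[/familyP fF' fWB]].
    split; last by rewrite -SB -escapes_step.
    apply/familyP => v; rewrite /F'; have := fF v; rewrite -SB inE.
    case: (boolP (v \in W)) => //= vW; rewrite FW // => fU.
    by case: ifP => [nW|/negbFE //]; rewrite !inE nW.
  have SB : S f = B.
    apply/setP => v; have := fF' v; rewrite inE /F'.
    have [/(subsetP BW) -> /setDP[_ ->] //|vB] := boolP (v \in B).
    by have [_ -> //|] := boolP (v \in W).
  split; rewrite ?SB //; last by rewrite escapes_step -/(S f) SB.
  apply/familyP => v; have := fF' v; rewrite /F'.
  have [vB /setDP[fU _]|_] := boolP (v \in B); first by rewrite FW // (subsetP BW).
  by have [vW /(subsetP WU) fU|//] := boolP (v \in W); rewrite FW.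
rewrite (IH W) ?subsetDl //; last 2 first.
- by rewrite cB; have := subset_leq_card BW; lia.
- by move=> v /setDP[vW /negbTE vB]; rewrite /F' vB vW.
rewrite (bigID (mem B)) /= -!mulnA mulnCA.
congr (_ * _).
  apply: eq_big => [v|v]; last first.
    by case/andP=> vWB /negbTE vB; move: vWB; rewrite /F' !inE vB /= => /negbTE ->.
  by rewrite !inE; case: (boolP (v \in B)) => [/(subsetP BW) ->|_] //=; rewrite andbT.
congr (_ * _).
  rewrite (eq_bigl (mem B)); last by move=> v; rewrite !inE; case: (v \in B); rewrite ?andbF.
  by rewrite -prod_nat_const; apply: eq_bigr => v /= vB; rewrite /F' (vB : v \in B).
exact: nb_forests_setD.
Qed.
End Escapes.

(** * Set partitions encoded by block minima *)

Lemma card_partitions_imset (T U : finType) (e : T -> U) (D : {set T}) b :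
  injective e ->
  #|[set P | partition P (e @: D) & #|P| == b]| = #|[set P | partition P D & #|P| == b]|.
Proof.
move=> e_inj; pose E (P : {set {set T}}) := [set e @: (A : {set T}) | A in P].
have E_inj : injective E by apply/imset_inj/imset_inj.
rewrite -[RHS](card_imset _ E_inj); apply: eq_card => P; apply/idP/imsetP.
  rewrite inE => /andP[partP cP].
  have PE : P = E [set e @^-1: (A : {set U}) | A in P].
    rewrite /E -imset_comp -[LHS]imset_id; apply: eq_in_imset => A AP /=.
    have AD : A \subset e @: D by have /and3P[/eqP <- _ _] := partP; apply: bigcup_sup.
    apply/setP => v; apply/idP/imsetP => [vA|[i]]; last by rewrite inE => ? ->.
    have /imsetP[i _ vi] := subsetP AD _ vA.
    by exists i; rewrite ?inE -?vi.
  exists [set e @^-1: (A : {set U}) | A in P] => //.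
  move: partP cP; rewrite {1 2}PE inE imset_partition // => ->.
  by rewrite card_imset //; apply: imset_inj.
case=> Q; rewrite inE => /andP[partQ cQ] ->.
by rewrite inE imset_partition // partQ card_imset //; apply: imset_inj.
Qed.

Section Partitions.
Variable n : nat.
Implicit Types (B M : {set 'I_n}) (h : {ffun 'I_n -> 'I_n}).

Lemma card_partitions_stirling2 B b :
  #|[set P | partition P B & #|P| == b]| = stirling2 #|B| b.
Proof.
have eB : B = enum_val @: [set: 'I_#|B|].
  apply/setP => v; apply/idP/imsetP => [vB|[i _ ->]]; last exact: enum_valP.
  by exists (enum_rank_in vB v); rewrite ?inE // enum_rankK_in.
by rewrite {1}eB card_partitions_imset //; apply: enum_val_inj.
Qed.

(* A partition of [B] is encoded by the map [h] sending each element of [B] to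
   the minimum of its block (and fixing the elements outside [B]). *)
Definition is_block_min B h : bool :=
  [forall v, if v \in B then [&& h v \in B, h v <= v & h (h v) == h v]
             else h v == v].

Lemma is_block_minP B h : reflect
  ((forall v, v \in B -> [/\ h v \in B, h v <= v & h (h v) = h v]) /\
   (forall v, v \notin B -> h v = v)) (is_block_min B h).
Proof.
apply: (iffP forallP) => [hB|[hB hB'] v].
  split=> v vB; have := hB v; rewrite ?vB; first by case/and3P=> ? ? /eqP.
  by rewrite (negbTE vB) => /eqP.
have [/hB[-> -> ->]|/hB' ->] := boolP (v \in B); by rewrite ?eqxx.
Qed.

(** Every partition is the kernel of the map to its block minima, and this map is determined by its
    kernel on [B]. *)
Lemma card_partitions_block_min B b :
  #|[set P | partition P B & #|P| == b]|
  = #|[set h | is_block_min B h & #|h @: B| == b]|.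
Proof.
rewrite -[RHS](card_in_imset (f := fun h : {ffun 'I_n -> 'I_n} => preim_partition h B)).
  apply: eq_card => P; apply/idP/imsetP => [|[h]]; last first.
    by rewrite !inE => /andP[_ cb] ->; rewrite preim_partitionP card_preim_partition.
  rewrite inE => /andP[partP cP]; have /and3P[/eqP covP trivP _] := partP.
  pose mn v := [arg min_(i < v in pblock P v) (i : nat)].
  have mnP v : v \in B -> mn v \in pblock P v /\ {in pblock P v, forall i : 'I_n, mn v <= i}.
    by move=> vB; rewrite /mn; case: arg_minnP => //; rewrite mem_pblock covP.
  have blkP v : v \in B -> pblock P (mn v) = pblock P v.
    by move=> vB; apply: same_pblock => //; have [] := mnP v vB.
  have mn_eq u v : u \in B -> v \in B -> pblock P u = pblock P v -> mn u = mn v.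
    move=> uB vB uv; have [u1 u2] := mnP u uB; have [v1 v2] := mnP v vB.
    by apply/val_inj/eqP; rewrite eqn_leq u2 ?uv // v2 // -uv.
  have mnB v : v \in B -> mn v \in B.
    by move=> vB; rewrite -covP -mem_pblock blkP //; have [] := mnP v vB.
  pose h := [ffun v => if v \in B then mn v else v].
  have hP : preim_partition h B = P.
    rewrite -[RHS](preim_partition_pblock partP); apply: eq_preim_partition => u v uB vB.
    rewrite !ffunE uB vB; apply/eqP/eqP => [uv|]; last exact: mn_eq.
    by rewrite -blkP // uv blkP.
  exists h => //; rewrite inE -card_preim_partition hP cP andbT.
  apply/is_block_minP; split=> v vB; rewrite !ffunE ?vB ?(negbTE vB) // mnB //.
  split=> //; last by apply: mn_eq; rewrite ?mnB ?blkP.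
  by have [_] := mnP v vB; apply; rewrite mem_pblock covP.
move=> h h'; rewrite !inE => /andP[/is_block_minP[hB hB'] _] /andP[/is_block_minP[gB gB'] _] hh'.
have eqE : {in B &, forall u v, (h u == h v) = (h' u == h' v)}.
  by move=> u v uB vB; rewrite -(@mem_pblock_preim _ _ h B) // -(@mem_pblock_preim _ _ h' B) // hh'.
apply/ffunP => v; have [vB|vB] := boolP (v \in B); last by rewrite hB' ?gB'.
have [h1 h2 h3] := hB v vB; have [g1 g2 g3] := gB v vB.
(* The common kernel gives [h' (h v) = h' v] and [h (h' v) = h v], so each of [h v] and [h' v] is at
   most the other. *)
have /eqP e1 : h' (h v) == h' v by rewrite -eqE // h3.
have /eqP e2 : h (h' v) == h v by rewrite eqE // g3.
have [_ a _] := gB _ h1; have [_ b' _] := hB _ g1.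
by apply/val_inj/eqP; rewrite eqn_leq -{1}e2 b' -{1}e1 a.
Qed.

(** Maps are grouped by their set [M] of minima: such a map fixes [M] and sends each other element
    of [B] to a freely chosen smaller element of [M]. *)
Lemma sum_block_min B b :
  \sum_(M : {set 'I_n} | (M \subset B) && (#|M| == b))
     \prod_(v in B :\: M) #|[set a in M | a < v]| = stirling2 #|B| b.
Proof.
rewrite -card_partitions_stirling2 card_partitions_block_min -sum1_card.
rewrite (partition_big (fun h => h @: B) (fun M => (M \subset B) && (#|M| == b))) /=; last first.
  move=> h; rewrite inE => /andP[/is_block_minP[hB _] ->]; rewrite andbT.
  by apply/subsetP => _ /imsetP[v /hB[? _ _] ->].
apply: eq_bigr => M /andP[MB /eqP cM]; rewrite sum1dep_card.
pose F v := if v \in B :\: M then [set a in M | a < v] else [set v].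
transitivity #|[set h : {ffun 'I_n -> 'I_n} | h \in family F]|.
  rewrite card_family_prod [RHS](bigID (mem (B :\: M))) /= [X in _ * X]big1; last first.
    by move=> v vBM; rewrite /F (negbTE vBM) cards1.
  by rewrite muln1; apply: eq_bigr => v vBM; rewrite /F vBM.
apply: eq_card => h; rewrite !inE -andbA.
apply/familyP/and3P => [hF|[/is_block_minP[hB hB'] _ /eqP hM] v].
  have hM v : v \in M -> h v = v.
    by move=> vM; have := hF v; rewrite /F inE vM /= => /set1P.
  have hBM v : v \in B -> h v \in M /\ h v <= v.
    move=> vB; have := hF v; rewrite /F inE vB andbT.
    have [vM _|vM /=] := boolP (v \in M); first by rewrite hM.
    by rewrite inE => /andP[-> /ltnW].
  have hBE : h @: B = M.
    apply/eqP; rewrite eqEsubset; apply/andP; split; apply/subsetP => v.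
      by case/imsetP=> u /hBM[? _] ->.
    by move=> vM; rewrite -(hM v vM) imset_f // (subsetP MB).
  rewrite hBE cM eqxx; split=> //; apply/is_block_minP; split=> v vB.
    by have [hvM hv] := hBM v vB; split=> //; [apply: (subsetP MB)|apply: hM].
  by have := hF v; rewrite /F inE (negbTE vB) andbF => /set1P.
have [vBM|vBM] := boolP (v \in B :\: M); rewrite /F ?vBM ?(negbTE vBM).
  have [vB vM] := setDP vBM; have [_ hv hhv] := hB v vB.
  rewrite inE -{1}hM imset_f //= ltn_neqAle hv andbT.
  by apply: contraNneq vM => /val_inj <-; rewrite -hM imset_f.
move: vBM; rewrite in_setD negb_and negbK => /orP[|/hB' ->]; last exact: set11.
by rewrite -hM => /imsetP[u /hB[_ _ huv] ->]; rewrite huv set11.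
Qed.
End Partitions.

(** Induction removing the least element, which has all the others above it; the removal changes no
    other factor. *)
Lemma prod_card_above n (M : {set 'I_n}) (r : 'I_n) :
  r \in M -> {in M, forall v : 'I_n, v <= r} ->
  \prod_(v in M) (if v == r then 1 else #|[set a in M | v < a]|) = (#|M|.-1)`!.
Proof.
move: {2}#|M| (erefl #|M|) => m; elim: m M => [|m IH] M cM rM Mr.
  by move: rM; rewrite (cards0_eq cM) inE.
pose x := [arg min_(i < r in M) (i : nat)].
have [xM xmin] : x \in M /\ {in M, forall i : 'I_n, x <= i}.
  by rewrite /x; case: arg_minnP.
have [xr|xr] := eqVneq x r.
  have -> : M = [set r].
    apply/setP => v; rewrite inE; apply/idP/eqP => [vM|-> //].
    by apply/val_inj/eqP; rewrite eqn_leq Mr //= -xr xmin.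
  by rewrite cards1 big_set1 eqxx.
have cMx : #|M :\ x| = m by move: cM; rewrite (cardsD1 x) xM => -[].
have rMx : r \in M :\ x by rewrite !inE eq_sym xr.
rewrite (big_setD1 x xM) /= (negbTE xr).
have -> : [set a in M | x < a] = M :\ x.
  apply/setP => a; rewrite !inE andbC; case: (boolP (a \in M)) => [aM|]; rewrite ?andbF //.
  by rewrite !andbT ltn_neqAle xmin // andbT eq_sym.
have m0 : 0 < m by rewrite -cMx card_gt0; apply/set0Pn; exists r.
rewrite cMx cM /= -[in RHS](prednK m0) factS prednK //.
congr (_ * _); rewrite -cMx -IH //; last by move=> v /setD1P[_ /Mr].
apply: eq_bigr => v /setD1P[vx vM]; congr (if _ then _ else _).
apply: eq_card => a; rewrite !inE; case: eqP => //= ->.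
by rewrite [v < _]ltnNge (xmin v vM) andbF.
Qed.

(* Pairs of a root and a parent function, the root being its own parent. *)
Definition tree_funs (V : finType) : {set V * {ffun V -> V}} :=
  [set T : V * {ffun V -> V} | (T.2 T.1 == T.1) && escapes T.2 [set~ T.1]].

(** * Parent functions counted by increasing ancestry *)

Section TreeFuns.
Variable n : nat.
Local Notation V := 'I_n.+1.
Implicit Types (f : {ffun V -> V}) (M R : {set V}) (r v : V).

(** The counterpart of [MD] for parent functions. The inequality is weak because the root is its own
    parent. *)
Definition increasing_ancestry f : {set V} :=
  [set v | [forall x, fconnect f v x ==> (x <= f x)]].

Lemma increasing_ancestryP f v :
  reflect (forall x, fconnect f v x -> x <= f x) (v \in increasing_ancestry f).
Proof.
rewrite inE; apply: (iffP forallP) => H x; first exact: implyP.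
by apply/implyP/H.
Qed.

Lemma increasing_ancestry_step f v :
  (v \in increasing_ancestry f) = (v <= f v) && (f v \in increasing_ancestry f).
Proof.
apply/increasing_ancestryP/andP => [H|[vf /increasing_ancestryP H] x].
  split; first by apply: H; apply: connect0.
  by apply/increasing_ancestryP => x fx; apply/H/(connect_trans (fconnect1 f v)).
by move/iter_findex; case: findex => [<- //|i <-]; rewrite iterSr; apply/H/fconnect_iter.
Qed.

(** The parents allowed when [M] is the increasing part, [r] its maximum and [R] the set of outside
    vertices attached to it. *)
Definition MD_family M R r : V -> {set V} := fun v =>
  if v == r then [set r] else if v \in M then [set a in M | v < a]
  else if v \in R then [set a in M | a < v] else ~: M.

(** Escaping makes every chain from outside [M] enter [M] through [R]; inside [M] the labels climb
    until [r] is reached. *)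
Lemma MD_familyP M R r f :
  r \in M -> {in M, forall v, v <= r} -> R \subset ~: M ->
  [&& (r, f) \in tree_funs V, increasing_ancestry f == M
    & [set v in ~: M | f v \in M] == R]
  = (f \in family (MD_family M R r)) && escapes f (~: M :\: R).
Proof.
move=> rM Mr RM.
have stepE : escapes f (~: M) = escapes f (~: M :\: [set v in ~: M | f v \in M]).
  by rewrite escapes_step; congr (escapes f (_ :\: _)); apply/setP => v; rewrite !inE negbK.
apply/and3P/andP => [[]|[/familyP fF fMR]].
  rewrite inE /= => /andP[/eqP fr fl] /eqP EM /eqP ER.
  have f_neq v : v != r -> f v != v.
    move=> vr; apply/eqP => fv.
    have /(escapesP _ _ fl)[i] : v \in [set~ r] by rewrite !inE.
    by rewrite !inE negbK iter_fix // (negbTE vr).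
  split; last first.
    rewrite -ER -stepE; apply/escapesP => v; rewrite inE => vM.
    have /(escapesP _ _ fl)[i] : v \in [set~ r] by rewrite !inE; apply: contraNneq vM => ->.
    by rewrite !inE negbK => /eqP fi; exists i; rewrite fi inE rM.
  apply/familyP => v; rewrite /MD_family; case: eqVneq => [->|vr]; first by rewrite fr set11.
  have := increasing_ancestry_step f v; rewrite EM.
  case: (boolP (v \in M)) => [vM /esym/andP[vf fM]|vM /esym/negbT].
    by rewrite inE fM ltn_neqAle vf andbT eq_sym f_neq.
  rewrite -ER !inE vM /= negb_and; case: (boolP (f v \in M)) => /= fM; last by rewrite inE.
  by rewrite orbF -ltnNge inE fM.
have fM v : v \in M -> f v \in M /\ (v != r -> v < f v).
  move=> vM; have := fF v; rewrite /MD_family vM; case: eqVneq => [->|_].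
    by move=> /set1P ->.
  by rewrite inE => /andP[].
have fr : f r = r by have := fF r; rewrite /MD_family eqxx => /set1P.
have fR v : v \in R -> f v \in M /\ f v < v.
  move=> vR; have := fF v; rewrite /MD_family vR.
  have := subsetP RM v vR; rewrite inE => vM; rewrite (negbTE vM).
  case: eqVneq => [vr|_]; first by rewrite vr rM in vM.
  by rewrite inE => /andP[].
have ER : [set v in ~: M | f v \in M] = R.
  apply/setP => v; rewrite !inE; apply/andP/idP => [[vM fvM]|vR]; last first.
    by have [-> _] := fR v vR; have := subsetP RM v vR; rewrite inE.
  apply: contraT => vR; have := fF v; rewrite /MD_family (negbTE vM) (negbTE vR).
  case: eqVneq => [vr|_]; first by rewrite vr rM in vM.
  by rewrite inE fvM.
have fl : escapes f (~: M) by rewrite stepE ER.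
have iterM v i : v \in M -> iter i f v \in M.
  by move=> vM; elim: i => //= i /fM[].
have reach_r v : v \in M -> exists i, iter i f v = r.
  move: {2}(n.+1 - v) (leqnn (n.+1 - v)) => m; elim: m v => [|m IH] v nv vM.
    by have := ltn_ord v; lia.
  have [vr|vr] := eqVneq v r; first by exists 0.
  have [fvM /(_ vr) vf] := fM v vM.
  have [|i fi] := IH (f v) _ fvM; last by exists i.+1; rewrite iterSr.
  by have := ltn_ord (f v); lia.
split; rewrite ?ER //.
  rewrite inE fr eqxx /=; apply/escapesP => v _.
  have [i iM] : exists i, iter i f v \in M.
    have [vM|vM] := boolP (v \in M); first by exists 0.
    by have [|i] := escapesP _ _ fl v; rewrite !inE // negbK; exists i.
  by have [j fj] := reach_r _ iM; exists (j + i); rewrite iterD fj !inE eqxx.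
apply/eqP/setP => v; apply/increasing_ancestryP/idP => [vA|vM x /iter_findex <-].
  (* A chain starting outside [M] enters [M] by a step from [R], and that step goes down. *)
  apply: contraT => vM.
  have [|i0] := escapesP _ _ fl v; rewrite !inE // negbK => i0M.
  case: (ex_minnP (ex_intro (fun i => iter i f v \in M) i0 i0M)) => -[|i] iM imin.
    by rewrite /= (negbTE vM) in iM.
  have yM : iter i f v \notin M by apply/negP => /imin; rewrite ltnn.
  have /fR[_] : iter i f v \in R by rewrite -ER !inE yM.
  by rewrite ltnNge vA ?fconnect_iter.
have := iterM v (findex f v x) vM; move: (iter _ _ _) => y /fM[_ fy].
by case: (eqVneq y r) => [->|/fy/ltnW //]; rewrite fr.
Qed.

(** The root must be the maximum of [M]; what remains is counted by [card_escapes] for [~: M :\: R]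
    inside [~: M]. *)
Lemma card_MD_fiber M R : M != set0 -> R \subset ~: M ->
  #|[set T in tree_funs V | (increasing_ancestry T.2 == M)
     && ([set v in ~: M | T.2 v \in M] == R)]|
  = #|M|.-1`! * (\prod_(v in R) #|[set a in M | a < v]|) * nb_forests #|~: M| #|R|.
Proof.
case/set0Pn=> x xM RM; pose r := [arg max_(i > x in M) (i : nat)].
have [rM Mr] : r \in M /\ {in M, forall v, v <= r} by rewrite /r; case: arg_maxnP.
transitivity #|[set f in family (MD_family M R r) | escapes f (~: M :\: R)]|.
  rewrite -[RHS](card_imset _ (f := fun f => (r, f))) => [|f g [] //].
  apply: eq_card => -[s f]; apply/idP/imsetP => [|[g]]; last first.
    by move=> gF [-> ->]; rewrite in_set in gF; rewrite in_set /= MD_familyP.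
  (* The root [s] lies in [M], its chain being constant, and the increasing chain of [r] reaches
     [s], so [r <= s]. *)
  rewrite in_set /= => H; have rs : s = r.
    have /and3P[] := H; rewrite inE /= => /andP[/eqP fs fl] /eqP EM _.
    have sM : s \in M.
      by rewrite -EM; apply/increasing_ancestryP => y /iter_findex <-; rewrite iter_fix // fs.
    apply/val_inj/eqP; rewrite eqn_leq Mr //=.
    have [->|rs] := eqVneq r s; first exact: leqnn.
    have /(escapesP _ _ fl)[i] : r \in [set~ s] by rewrite !inE.
    rewrite !inE negbK => /eqP <-.
    have : r \in increasing_ancestry f by rewrite EM.
    move/increasing_ancestryP => rA; elim: i => //= i IH.
    exact: leq_trans IH (rA _ (fconnect_iter _ _ _)).
  by exists f; rewrite ?rs // in_set -MD_familyP // -rs.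
rewrite (@card_escapes _ (~: M)) ?subsetDl //; last first.
  move=> v; rewrite !inE /MD_family => /andP[/negbTE vR vM].
  by rewrite (negbTE vM) vR; case: eqVneq => // vr; rewrite vr rM in vM.
rewrite nb_forests_setD //; congr (_ * _).
rewrite (bigID (mem M)) /=; congr (_ * _).
  rewrite -(prod_card_above rM Mr); apply: eq_big => [v|v /andP[_ vM]].
    by rewrite !inE; case: (v \in M); rewrite ?andbF.
  by rewrite /MD_family vM; case: ifP => //; rewrite cards1.
have RnM v : v \in R -> v \notin M by move/(subsetP RM); rewrite inE.
apply: eq_big => [v|v /andP[]].
  by rewrite !inE; case: (boolP (v \in R)) => [/RnM ->//|_]; case: (v \in M).
rewrite !inE /MD_family => + vM; rewrite vM andbT negbK (negbTE vM) => ->.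
by case: eqVneq => // vr; rewrite vr rM in vM.
Qed.

Lemma card_tree_funs_MD k :
  #|[set T in tree_funs V | #|increasing_ancestry T.2| == k.+1]|
  = \sum_(M : {set V} | #|M| == k.+1) \sum_(R : {set V} | R \subset ~: M)
      k`! * (\prod_(v in R) #|[set a in M | a < v]|) * nb_forests (n - k) #|R|.
Proof.
rewrite -sum1_card (partition_big (fun T => increasing_ancestry T.2)
  (fun M : {set V} => #|M| == k.+1)) /=; last by move=> T; rewrite inE => /andP[].
apply: eq_bigr => M /eqP cM.
rewrite (partition_big (fun T : V * {ffun V -> V} => [set v in ~: M | T.2 v \in M])
  (fun R : {set V} => R \subset ~: M)) /=; last first.
  by move=> T _; apply/subsetP => v; rewrite inE => /andP[].
apply: eq_bigr => R RM; rewrite sum1dep_card.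
have M0 : M != set0 by rewrite -card_gt0 cM.
have cCM : #|~: M| = n - k by have := cardsC M; rewrite cM card_ord; lia.
rewrite -cCM -[k]/(k.+1.-1) -cM -card_MD_fiber //; apply: eq_card => T.
rewrite !inE; case: (eqVneq (increasing_ancestry _) M) => [->|]; rewrite ?andbF //.
by rewrite eqxx !andbT -!andbA.
Qed.

(** With [B = M :|: R] and the sums exchanged, the sum over [M] is a Stirling number by
    [sum_block_min], and all depends on [#|B|] alone, which is m + 1. *)
Lemma card_tree_funs_MDE k : k <= n ->
  #|[set T in tree_funs V | #|increasing_ancestry T.2| == k.+1]|
  = \sum_(k <= m < n.+1) 'C(n.+1, m.+1) * stirling2 m.+1 k.+1 * k`! *
       nb_forests (n - k) (m - k).
Proof.
move=> kn; rewrite card_tree_funs_MD.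
transitivity (\sum_(M : {set V} | #|M| == k.+1) \sum_(B : {set V} | M \subset B)
  k`! * (\prod_(v in B :\: M) #|[set a in M | a < v]|) * nb_forests (n - k) (#|B| - k.+1)).
  apply: eq_bigr => M /eqP cM.
  rewrite (reindex_onto (fun B => B :\: M) (fun R => R :|: M)) /=; last first.
    move=> R RM; rewrite setDUl setDv setU0; apply/setP => v; rewrite inE.
    by case: (boolP (v \in R)) => [/(subsetP RM)|]; rewrite ?inE ?andbF // => ->.
  apply: eq_big => [B|B /andP[_ /eqP E]].
    rewrite subsetDr /=; apply/eqP/idP => [<-|MB]; first exact: subsetUr.
    by rewrite setUC -{1}(setIidPr MB) setID.
  by rewrite cardsD (setIidPr _) ?cM // -E subsetUr.
rewrite (exchange_big_dep xpredT) //=.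
pose g j := k`! * stirling2 j k.+1 * nb_forests (n - k) (j - k.+1).
transitivity (\sum_(B : {set V} | B \subset [set: V]) g #|B|).
  rewrite [RHS](eq_bigl xpredT); last by move=> B; rewrite subsetT.
  apply: eq_bigr => B _; rewrite -big_distrl -big_distrr /= /g; congr (_ * _ * _).
  by rewrite -sum_block_min; apply: eq_bigl => M; rewrite andbC.
rewrite sum_subsets_card cardsT card_ord.
rewrite -(big_mkord xpredT (fun s => 'C(n.+1, s) * g s)).
(* Sets [B] with at most [k] elements contain no set [M] of size [k.+1]. *)
rewrite (@big_cat_nat _ _ _ k.+1) ?ltnS //= 1?ltnW //.
rewrite [X in X + _]big1_seq ?add0n; last first.
  move=> j; rewrite mem_index_iota => /and3P[_ _ jk].
  rewrite /g -(card_ord j) -cardsT -sum_block_min big_pred0 ?muln0 // => M.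
  apply/negP => /andP[_ /eqP cM]; have := max_card M; rewrite cM card_ord; lia.
rewrite -(addn1 k) -(addn1 n.+1) big_addn addnK; apply: eq_bigr => m _.
rewrite /g !addn1 subSS; ring.
Qed.
End TreeFuns.

(** * Rooted trees as parent functions *)

Lemma set2_eq (T : finType) (a b c d : T) :
  [set a; b] = [set c; d] -> (a = c /\ b = d) \/ (a = d /\ b = c).
Proof.
move=> E; have := set21 a b; have := set22 a b; rewrite E.
move=> /set2P[] eb /set2P[] ea; rewrite ea eb in E *; [left|by right|by left|left].
  by have := set22 c d; rewrite -E !inE orbb => /eqP ->.
by have := set21 c d; rewrite -E !inE orbb => /eqP ->.
Qed.

(** The parent of a vertex is a neighbour strictly closer to [r]. *)
Lemma exists_parent (V : finType) (e : rel V) (r : V) :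
  (forall v, connect e v r) ->
  exists f : {ffun V -> V}, (r, f) \in tree_funs V /\ forall v, v != r -> e v (f v).
Proof.
move=> er.
have lenP v : exists m, [exists p : m.-tuple V, path e v p && (last v p == r)].
  have /connectP[p ep ->] := er v.
  by exists (size p); apply/existsP; exists (in_tuple p); rewrite ep eqxx.
pose dist v := ex_minn (lenP v).
have step v : v != r -> exists u, e v u && (dist u < dist v).
  rewrite {2}/dist; case: ex_minnP => m /existsP[p /andP[ep /eqP lp]] _ vr.
  case: {p}(tval p) (size_tuple p) ep lp => [_ _ /= vr'|u p <- /= /andP[vu ep] lp].
    by rewrite vr' eqxx in vr.
  exists u; rewrite vu /dist ltnS; case: ex_minnP => m' _; apply.
  by apply/existsP; exists (in_tuple p); rewrite ep lp /=.
pose f := [ffun v => if v == r then r else odflt v [pick u | e v u && (dist u < dist v)]].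
have fP v : v != r -> e v (f v) && (dist (f v) < dist v).
  rewrite ffunE => vr; rewrite (negbTE vr); case: pickP => // no.
  by have [u] := step v vr; rewrite no.
exists f; split; last by move=> v /fP/andP[].
rewrite inE /= ffunE eqxx eqxx /=; apply/escapesP => v _.
move: {2}(dist v).+1 (ltnSn (dist v)) => m; elim: m v => // m IH v dv.
have [->|vr] := eqVneq v r; first by exists 0; rewrite !inE eqxx.
have /andP[_ lt_d] := fP v vr.
have [|i fi] := IH (f v); first exact: leq_trans lt_d dv.
by exists i.+1; rewrite iterSr.
Qed.

Lemma adj_sym (V : finType) (E : {set {set V}}) : symmetric (adj E).
Proof. by move=> u v; rewrite /adj setUC. Qed.

(** The root, being its own parent, is left out: it would give a singleton edge. *)
Definition parent_edges (V : finType) (r : V) (f : V -> V) : {set {set V}} :=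
  [set [set v; f v] | v in [set~ r]].

Lemma adj_parent_edges (V : finType) (r : V) (f : V -> V) u v :
  adj (parent_edges r f) u v = (u != r) && (f u == v) || (v != r) && (f v == u).
Proof.
apply/imsetP/orP => [[w]|[]/andP[wr /eqP <-]].
- by rewrite !inE => wr /set2_eq[[-> ->]|[-> ->]]; rewrite wr eqxx; [left|right].
- by exists u; rewrite ?inE.
- by exists v; rewrite ?inE // setUC.
Qed.

Section TreeFunGraph.
Variables (V : finType) (r : V) (f : {ffun V -> V}).
Hypothesis tf : (r, f) \in tree_funs V.

Lemma tree_fun_root : f r = r.
Proof. by have := tf; rewrite inE /= => /andP[/eqP]. Qed.

(** The number of steps to the root, an induction measure for what follows. *)
Lemma exists_depth : exists d : V -> nat, forall v, v != r -> d v = (d (f v)).+1.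
Proof.
have := tf; rewrite inE /= => /andP[_ /escapesP fr].
have reach v : exists i, iter i f v == r.
  have [->|vr] := eqVneq v r; first by exists 0.
  by have [|i] := fr v; rewrite !inE // negbK; exists i.
exists (fun v => ex_minn (reach v)) => v vr.
case: ex_minnP => -[|i] iv min; first by rewrite iv in vr.
case: ex_minnP => j jv minj; apply/eqP; rewrite eqn_leq min /=; last by rewrite -iterS iterSr.
by rewrite ltnS minj // -iterSr.
Qed.

Lemma connected_parent_edges : connected (parent_edges r f).
Proof.
have [d dE] := exists_depth.
have to_r v : connect (adj (parent_edges r f)) v r.
  move: {2}(d v).+1 (ltnSn (d v)) => m; elim: m v => // m IH v dv.
  have [->|vr] := eqVneq v r; first exact: connect0.
  apply: (@connect_trans _ _ (f v)); last by apply: IH; rewrite -ltnS -dE.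
  by apply: connect1; rewrite adj_parent_edges vr eqxx.
apply/forallP => u; apply/forallP => v; apply: connect_trans (to_r u) _.
by rewrite (sym_connect_sym (@adj_sym _ _)).
Qed.

(** In a cycle of more than two vertices, one of maximal depth can only have its parent as
    neighbour, so its two neighbours coincide. *)
Lemma tree_parent_edges : tree (parent_edges r f).
Proof.
have [d dE] := exists_depth.
have f_neq v : v != r -> f v != v.
  by move=> vr; apply/eqP => fv; have := dE v vr; rewrite fv => /n_Sn.
apply/and3P; split; [|exact: connected_parent_edges|].
  by apply/forall_inP => _ /imsetP[v + ->]; rewrite !inE cards2 => /f_neq; rewrite eq_sym => ->.
apply/forallP => k; apply/forallP => -[c /= /eqP <-]; apply/implyP => /andP[/= cyc unq].
rewrite leqNgt; apply/negP => c2.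
have [x xc xmax] : exists2 x, x \in c & forall y, y \in c -> d y <= d x.
  have [x0 x0c] : exists x, x \in c.
    by case: c c2 {cyc unq} => // x s _; exists x; rewrite mem_head.
  by case: (arg_maxnP d x0c) => x xc xm; exists x.
have [i c' rotc] := rot_to xc.
have : cycle (adj (parent_edges r f)) (x :: c') by rewrite -rotc rot_cycle.
have sc' : 2 < size (x :: c') by rewrite -rotc size_rot.
have : uniq (x :: c') by rewrite -rotc rot_uniq.
have xmax' y : y \in x :: c' -> d y <= d x by rewrite -rotc mem_rot => /xmax.
have adjx y : y \in x :: c' -> adj (parent_edges r f) x y -> f x = y.
  move=> /xmax' yx; rewrite adj_parent_edges => /orP[/andP[_ /eqP]//|/andP[yr /eqP fy]].
  by have := dE y yr; rewrite fy => dy; rewrite dy ltnn in yx.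
case: c' sc' adjx {rotc xmax'} => [//|y c'].
case/lastP: c' => [//|c' z].
rewrite -rcons_cons => _ adjx; rewrite /cycle rcons_path last_rcons.
move=> /= /and3P[_ yz _] /andP[/andP[xy _] zx].
have fy : f x = y by apply: adjx => //; rewrite !inE eqxx orbT.
have fz : f x = z by apply: adjx; rewrite 1?adj_sym // !inE mem_rcons inE eqxx !orbT.
by rewrite -fy fz mem_rcons inE eqxx in yz.
Qed.
End TreeFunGraph.

(** Induction on depth: if [g] oriented the edge from [v] to [f v] the other way, the induction
    hypothesis at [f v] would give [f (f v) = v], against the depths. *)
Lemma parent_edges_inj (V : finType) (r : V) (f g : {ffun V -> V}) :
  (r, f) \in tree_funs V -> (r, g) \in tree_funs V ->
  parent_edges r f = parent_edges r g -> f = g.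
Proof.
move=> tf tg E; have [d dE] := exists_depth tf; apply/ffunP => v.
move: {2}(d v).+1 (ltnSn (d v)) => m; elim: m v => // m IH v dv.
have [->|vr] := eqVneq v r; first by rewrite (tree_fun_root tf) (tree_fun_root tg).
have : adj (parent_edges r g) v (f v) by rewrite -E adj_parent_edges vr eqxx.
rewrite adj_parent_edges => /orP[/andP[_ /eqP //]|/andP[fr /eqP gf]].
have dfv := dE v vr; have dffv := dE _ fr.
have : f (f v) = v by rewrite IH // -ltnS -dfv.
by move=> ffv; rewrite ffv in dffv; lia.
Qed.

(** Parents chosen by connectedness give a spanning tree inside [E]; a further edge of [E] would
    close one of its paths into a cycle. *)
Lemma tree_parent_edges_onto (V : finType) (r : V) (E : {set {set V}}) :
  tree E -> exists2 f : {ffun V -> V}, (r, f) \in tree_funs V & E = parent_edges r f.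
Proof.
case/and3P=> simpE connE acycE.
have [|f [tf fE]] := @exists_parent V (adj E) r.
  by move=> v; have /forallP/(_ v)/forallP := connE; apply.
have subE : parent_edges r f \subset E.
  by apply/subsetP => _ /imsetP[v + ->]; rewrite !inE => /fE.
exists f => //; apply/eqP; rewrite eqEsubset subE andbT; apply/subsetP => A AE.
have /forall_inP/(_ A AE)/cards2P[u [v [uv EA]]] := simpE.
subst A; apply: contraT => nE.
have /forallP/(_ u)/forallP/(_ v)/connectP[p0 ep0 vp0] := connected_parent_edges tf.
case/shortenP: ep0 vp0 => p ep unq _ vp.
have sz : size (u :: p) < #|V|.+1 by rewrite ltnS -(card_uniqP unq) max_card.
have cyc : cycle (adj E) (u :: p).
  rewrite /cycle rcons_path -vp adj_sym {2}/adj AE andbT.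
  by apply: sub_path ep => x y; apply: (subsetP subE).
have /forallP/(_ (Ordinal sz))/forallP/(_ (in_tuple (u :: p))) := acycE.
rewrite /ucycleb cyc unq /=.
(* Length 0 would give [u = v], and length 1 would put the edge in the spanning tree; so the cycle
   has at least three vertices. *)
case: p ep vp {sz unq cyc} => [_ vu|w [|w' p] //= + vw _]; first by rewrite vu eqxx in uv.
by rewrite /adj -vw (negbTE nE).
Qed.

(** * Maximal decreasing subtrees in terms of parent functions *)

Section MaximalDecreasing.
Variable n : nat.
Local Notation V := 'I_n.+1.

(** A decreasing path from the root can only step from parent to child, as [x <= f x] at each vertex
    met. Conversely, the parent chain of [v] read backwards is such a path. *)
Lemma MD_parent_edges (r : V) (f : {ffun V -> V}) :
  (r, f) \in tree_funs V -> MD (r, parent_edges r f) = increasing_ancestry f.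
Proof.
move=> tf; have fr := tree_fun_root tf; have [d dE] := exists_depth tf.
pose gt := fun x y : V => y < x.
have rA : r \in increasing_ancestry f.
  by apply/increasing_ancestryP => x /iter_findex <-; rewrite iter_fix // fr.
apply/setP => v; rewrite inE; apply/existsP/idP => [[l /existsP[p /= /and4P[ep _ /eqP <- sp]]]|].
  suff lastA (s : seq V) : forall x, x \in increasing_ancestry f ->
      path (adj (parent_edges r f)) x s -> path gt x s -> last x s \in increasing_ancestry f.
    exact: lastA rA ep sp.
  elim: s => //= y s IH x xA /andP[xy es] /andP[yx ss].
  apply: IH => //; rewrite increasing_ancestry_step.
  move: xy; rewrite adj_parent_edges => /orP[/andP[_ /eqP fx]|/andP[_ /eqP ->]].
    by move: xA; rewrite (increasing_ancestry_step f x) fx leqNgt (yx : y < x).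
  by rewrite ltnW.
suff exP : forall v, v \in increasing_ancestry f ->
    exists p, [/\ path (adj (parent_edges r f)) r p, path gt r p & last r p = v].
  move=> /exP[p [ep gp lp]].
  have unq : uniq (r :: p).
    apply: (@sorted_uniq _ gt) => //; last by move=> x; rewrite /gt ltnn.
    by move=> y x z; rewrite /gt => xy yz; apply: ltn_trans yz xy.
  have sp : size p < n.+1.
    by have := max_card (mem (r :: p)); rewrite (card_uniqP unq) card_ord.
  exists (Ordinal sp); apply/existsP; exists (in_tuple p).
  by apply/and4P; split=> //; apply/eqP.
clear v => v; move: {2}(d v).+1 (ltnSn (d v)) => m; elim: m v => // m IH v dv vA.
have [->|vr] := eqVneq v r; first by exists [::].
have := vA; rewrite increasing_ancestry_step => /andP[vf fA].
have [|p [ep gp lp]] := IH (f v) _ fA; first by rewrite -ltnS -dE.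
exists (rcons p v); rewrite !rcons_path last_rcons ep gp lp; split=> //.
  by rewrite adj_parent_edges vr eqxx orbT.
rewrite /= /gt ltn_neqAle vf andbT; apply/eqP => /val_inj fv.
by have := dE v vr; rewrite -fv => /n_Sn.
Qed.

Lemma card_trees_MD k :
  #|trees_MD n k| = #|[set T in tree_funs V | #|increasing_ancestry T.2| == k.+1]|.
Proof.
rewrite -[RHS](@card_in_imset _ _ (fun T : V * {ffun V -> V} => (T.1, parent_edges T.1 T.2))).
  apply: eq_card => -[r E]; apply/idP/imsetP => [|[[s f]]].
    rewrite !inE /= => /andP[/(tree_parent_edges_onto r)[f tf ->]].
    by rewrite MD_parent_edges // => cM; exists (r, f); rewrite // inE tf.
  rewrite in_set => /andP[tf cM] [-> ->].
  by rewrite !inE /= tree_parent_edges // MD_parent_edges.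
move=> [r f] [s g] /setIdP[tf _] /setIdP[tg _] [/= rs].
by subst s => /(parent_edges_inj tf tg) ->.
Qed.
End MaximalDecreasing.

(** * Finite differences *)

Import GRing.Theory.
Local Open Scope ring_scope.

Definition diff (g : int -> int) (x : int) : int := g (x + 1) - g x.

Lemma eq_iter_diff k (g h : int -> int) : g =1 h -> iter k diff g =1 iter k diff h.
Proof. by move=> gh; elim: k => //= k IH x; rewrite /diff !IH. Qed.

Lemma iter_diffS k (g : int -> int) x :
  iter k.+1 diff g x = iter k diff g (x + 1) - iter k diff g x.
Proof. by []. Qed.

Lemma iter_diff_shift k (g : int -> int) c x :
  iter k diff (fun y => g (y + c)) x = iter k diff g (x + c).
Proof.
elim: k x => // k IH x; rewrite !iter_diffS !IH.
by rewrite addrAC.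
Qed.

Lemma iter_diffM k a (g : int -> int) x :
  iter k diff (fun y => a * g y) x = a * iter k diff g x.
Proof. by elim: k x => // k IH x; rewrite !iter_diffS !IH mulrBr. Qed.

Lemma iter_diffB k (g h : int -> int) x :
  iter k diff (fun y => g y - h y) x = iter k diff g x - iter k diff h x.
Proof. by elim: k x => // k IH x; rewrite !iter_diffS !IH; ring. Qed.

Lemma iter_diff_sum k m (G : nat -> int -> int) x :
  iter k diff (fun y => \sum_(i < m) G i y) x = \sum_(i < m) iter k diff (G i) x.
Proof. by elim: k x => // k IH x; rewrite !iter_diffS !IH -sumrB. Qed.

(** The Leibniz rule for the factor [y]. *)
Lemma iter_diff_mulX k (g : int -> int) x :
  iter k.+1 diff (fun y => y * g y) x
  = (x + k.+1%:Z) * iter k.+1 diff g x + k.+1%:Z * iter k diff g x.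
Proof.
elim: k x => [|k IH] x; first by rewrite /= /diff; ring.
rewrite iter_diffS !IH (iter_diffS k.+1 g x) (iter_diffS k g x) !(intS k.+1).
set a := iter k.+1 diff g (x + 1); set b := iter k diff g (x + 1).
by set c := iter k diff g x; ring.
Qed.

Lemma iter_diff_expr_small n k x :
  (n < k)%N -> iter k diff (fun y => y ^+ n) x = 0.
Proof.
elim: n k x => [|n IH] [|k] x nk //.
  suff {nk}: iter k.+1 diff (fun y => y ^+ 0) =1 fun=> 0 by exact.
  elim: k => [|k IH] y; first by rewrite /= /diff !expr0 subrr.
  by rewrite iter_diffS !IH subrr.
rewrite (@eq_iter_diff _ _ (fun y => y * y ^+ n)); last by move=> y; rewrite exprS.
by rewrite iter_diff_mulX !IH ?mulr0 // ltnW.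
Qed.

(** Pascal's rule. The arguments run down from [x + k], so that x = n - k gives n - i. *)
Lemma iter_diffE k (g : int -> int) x :
  iter k diff g x
  = \sum_(0 <= i < k.+1) (-1) ^+ i * ('C(k, i))%:Z * g (x + k%:Z - i%:Z).
Proof.
elim: k x => [|k IH] x.
  by rewrite big_nat1 /= !mul1r addr0 subr0.
rewrite iter_diffS !IH !big_mkord big_ord_recl [RHS]big_ord_recl.
rewrite [in X in _ - X]big_ord_recr [in X in _ = _ + X]big_ord_recr /=.
rewrite !bin0 !binn (_ : x + 1 + k%:Z = x + k.+1%:Z); last by rewrite intS; ring.
rewrite opprD addrA -addrA -addrA; congr (_ + _); rewrite addrA -sumrB.
congr (_ + _).
  apply: eq_bigr => i _; rewrite binS PoszD /bump add1n.
  have -> : x + k.+1%:Z - i.+1%:Z = x + k%:Z - i%:Z by rewrite !intS; ring.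
  by rewrite exprS; ring.
rewrite /bump add1n exprS.
have -> : x + k.+1%:Z - k.+1%:Z = x + k%:Z - k%:Z by ring.
ring.
Qed.

(** * Functions covering a prescribed set *)

Section Onto.
Variables X Y : finType.

(** Induction on [K], removing [a]: from the functions covering [K :\ a], those avoiding [a], with
    values in [A :\ a], are subtracted. This is one more difference. *)
Lemma card_ffuns_onto (A K : {set Y}) : K \subset A ->
  #|[set f in ffun_on (mem A) | K \subset f @: [set: X] ]|%:Z
  = iter #|K| diff (fun y => y ^+ #|X|) (#|A|%:Z - #|K|%:Z).
Proof.
move: {2}#|K| (erefl #|K|) => k; elim: k K A => [|k IH] K A cK KA.
  have -> := cards0_eq cK; rewrite cards0 subr0 /=.
  rewrite -[#|A|%:Z]natz -natrX natz -card_ffun_on; congr (_%:Z); apply: eq_card => f.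
  by rewrite !inE sub0set andbT.
have [a aK] : exists a, a \in K by apply/set0Pn; rewrite -cards_eq0 cK.
have aA := subsetP KA _ aK.
have cKa : #|K :\ a| = k by move: cK; rewrite (cardsD1 a) aK => -[].
have KaA : K :\ a \subset A by apply: subset_trans KA; apply: subD1set.
have KaAa : K :\ a \subset A :\ a by apply: setSD.
rewrite cK iter_diffS.
have -> : #|A|%:Z - k.+1%:Z + 1 = #|A|%:Z - k%:Z by rewrite intS; ring.
have -> : #|A|%:Z - k.+1%:Z = #|A :\ a|%:Z - k%:Z.
  by rewrite (cardsD1 a A) aA /= intS PoszD; ring.
have := IH _ _ cKa KaA; have := IH _ _ cKa KaAa; rewrite cKa => <- <-.
rewrite -(cardsID [set f : {ffun X -> Y} | a \in f @: [set: X]]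
  [set f in ffun_on (mem A) | K :\ a \subset _]) PoszD.
set S1 := _ :&: _; set S2 := _ :\: _.
have -> : S2 = [set f in ffun_on (mem (A :\ a)) | K :\ a \subset f @: [set: X]].
  apply/setP => f; rewrite !inE.
  rewrite andbA; congr (_ && _); apply/andP/ffun_onP => [[nf /ffun_onP fA] x|fA].
    rewrite !inE fA andbT; apply: contra nf => /eqP <-; exact: imset_f (in_setT x).
  split; last by apply/ffun_onP => x; have /setD1P[] := fA x.
  by apply/imsetP => -[x _ ax]; have := fA x; rewrite !inE -ax eqxx.
rewrite addrK; congr (_%:Z); apply: eq_card => f; rewrite !inE -andbA; congr (_ && _).
by rewrite -{1}(setD1K aK) subUset sub1set andbC.
Qed.
End Onto.

(** * Stirling numbers and the binomial identity *)

Lemma stirling2_diff m k :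
  (k`! * stirling2 m k)%N%:Z = iter k diff (fun y => y ^+ m) 0.
Proof.
have := @card_ffuns_onto 'I_m 'I_k setT setT (subsetT _).
rewrite !cardsT !card_ord subrr => <-; congr (_%:Z).
(* Surjections onto ['I_k] are grouped by kernel: each partition into [k] blocks carries k! of
   them. *)
rewrite -sum1_card (partition_big (fun g : {ffun 'I_m -> 'I_k} => preim_partition g setT)
  (mem [set P : {set {set 'I_m}} | partition P [set: 'I_m] & #|P| == k])) /=; last first.
  move=> g; rewrite !inE preim_partitionP card_preim_partition /=.
  rewrite subTset => /andP[_ /eqP ->].
  by rewrite cardsT card_ord.
rewrite mulnC /stirling2 -sum_nat_const; apply: eq_bigr => P.
rewrite inE => /andP[partP /eqP cP].
rewrite sum1dep_card -ffactnn -{2}cP -{1}[k]card_ord -card_preim_partition_eq //.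
apply: eq_card => g; rewrite !inE andbC andb_idr // => /eqP gP.
apply/andP; split; first by apply/ffun_onP => x; rewrite inE.
by rewrite subTset eqEcard subsetT /= cardsT card_ord -card_preim_partition gP cP.
Qed.

(** After multiplication by k + 1 the left side is a difference of order k + 1 at 0, and the Leibniz
    rule there yields k + 1 times the value at 1. *)
Lemma fact_stirling2_succ m k :
  (k`! * stirling2 m.+1 k.+1)%N%:Z = iter k diff (fun y => y ^+ m) 1.
Proof.
apply: (@mulfI _ k.+1%:Z) => //.
rewrite -PoszM mulnA -factS stirling2_diff.
rewrite (@eq_iter_diff _ _ (fun y => y * y ^+ m)); last by move=> y; rewrite exprS.
by rewrite iter_diff_mulX iter_diffS !add0r; ring.
Qed.

Lemma binomial_sum_diff (n k : nat) (N : int) : N = n%:Z - k%:Z ->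
  \sum_(m < n.+1) ('C(n.+1, m.+1))%:Z * N ^+ (n - m) * (m%:Z - k%:Z)
                  * iter k diff (fun y => y ^+ m) 1
  = N * iter k diff (fun y => y ^+ n) N.
Proof.
move=> NE.
(* The quotient of (y + N)^(n + 1) - N^(n + 1) by y, as [qE] shows. *)
pose q (y : int) := \sum_(m < n.+1) ('C(n.+1, m.+1))%:Z * N ^+ (n - m) * y ^+ m.
(* Here m - k is split as (m + 1) - (k + 1), with (m + 1) C(n + 1, m + 1) = (n + 1) C(n, m). *)
have pE y : \sum_(m < n.+1) ('C(n.+1, m.+1))%:Z * N ^+ (n - m) * (m%:Z - k%:Z) * y ^+ m
    = n.+1%:Z * (y + N) ^+ n - k.+1%:Z * q y.
  rewrite /q (addrC y) exprDn !mulr_sumr -sumrB; apply: eq_bigr => m _.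
  have: (n.+1 * 'C(n, m))%N%:Z = (m.+1 * 'C(n.+1, m.+1))%N%:Z by rewrite (mul_bin_diag n.+1).
  rewrite !PoszM -mulr_natr natz => E.
  by rewrite [X in _ = X - _]mulrCA E !intS; ring.
have qE y : y * q y = (y + N) ^+ n.+1 - N ^+ n.+1.
  rewrite (addrC y) exprDn big_ord_recl subn0 expr0 mulr1 bin0 mulr1n addrAC subrr add0r.
  rewrite /q mulr_sumr; apply: eq_bigr => m _.
  by rewrite lift0 subSS -mulr_natr natz exprS; ring.
transitivity (iter k diff (fun y => n.+1%:Z * (y + N) ^+ n - k.+1%:Z * q y) 1).
  rewrite -(eq_iter_diff _ pE).
  rewrite (iter_diff_sum k n.+1 (fun m y =>
    ('C(n.+1, m.+1))%:Z * N ^+ (n - m) * (m%:Z - k%:Z) * y ^+ m)).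
  apply: eq_bigr => m _.
  by rewrite iter_diffM.
rewrite iter_diffB !iter_diffM (iter_diff_shift k (fun y => y ^+ n)).
(* Leibniz at 0 turns the left side into D^(k + 1)[y q](0), and the constant in [qE] is killed. *)
have -> : k.+1%:Z * iter k diff q 1 = iter k.+1 diff (fun y => y ^+ n.+1) N.
  rewrite -[in RHS](add0r N) -(iter_diff_shift k.+1 (fun y => y ^+ n.+1)).
  transitivity (iter k.+1 diff (fun y => y * q y) 0).
    by rewrite iter_diff_mulX iter_diffS !add0r; ring.
  rewrite (@eq_iter_diff _ _ (fun y => (y + N) ^+ n.+1 - N ^+ n.+1 * y ^+ 0)).
    by rewrite iter_diffB iter_diffM iter_diff_expr_small // mulr0 subr0.
  by move=> y; rewrite qE mulr1.
rewrite (@eq_iter_diff k.+1 _ (fun y => y * y ^+ n)); last by move=> y; rewrite exprS.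
rewrite iter_diff_mulX (addrC 1) iter_diffS.
set a := iter _ _ _ (N + 1); set b := iter _ _ _ N.
by rewrite NE !intS; ring.
Qed.

(** For k < n, multiplying by n - k brings the sum to the form of [binomial_sum_diff]. *)
Lemma stirling_sum_diff (n k : nat) : (k <= n)%N ->
  (\sum_(k <= m < n.+1)
       'C(n.+1, m.+1) * stirling2 m.+1 k.+1 * k`! *
       (if m == n then 1 else (n - k) ^ (n - m - 1) * (m - k)))%N%:Z
  = iter k diff (fun y => y ^+ n) (n%:Z - k%:Z).
Proof.
rewrite leq_eqVlt => /predU1P[->|ltkn].
  (* At k = n the factor n - k cannot be cancelled; a single term remains, and D^n[y^n] takes the
     same value at 0 and 1. *)
  rewrite big_nat1 eqxx binn mul1n muln1 mulnC fact_stirling2_succ subrr.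
  apply/eqP; rewrite -subr_eq0 -[X in iter _ _ _ X - _]add0r -iter_diffS.
  by rewrite iter_diff_expr_small.
have N0 : n%:Z - k%:Z != 0 by lia.
apply: (mulfI N0); rewrite -binomial_sum_diff // -[X in _ * X = _]natz natr_sum mulr_sumr.
rewrite -[RHS](big_mkord xpredT (fun m =>
  ('C(n.+1, m.+1))%:Z * (n%:Z - k%:Z) ^+ (n - m) * (m%:Z - k%:Z)
    * iter k diff (fun y => y ^+ m) 1)).
(* Terms with m < k vanish, since D^k kills y^m. *)
rewrite [RHS](@big_cat_nat _ _ _ k) //=; last by lia.
rewrite [X in _ = X + _]big1_seq; last first.
  move=> m; rewrite mem_index_iota => /and3P[_ _ ltmk].
  by rewrite iter_diff_expr_small // mulr0.
rewrite add0r; apply: eq_big_nat => m /andP[km mn].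
(* At m = n, the conventional value 1 times n - k agrees with (n - k)^0 (m - k). *)
rewrite natz -fact_stirling2_succ; case: eqVneq => [->|ne].
  by rewrite subnn muln1 !PoszM; ring.
rewrite [in RHS](_ : (n - m = (n - m - 1).+1)%N); last by lia.
rewrite !PoszM exprS -!subzn ?(ltnW ltkn) //.
have -> : ((n - k) ^ (n - m - 1))%N%:Z = (n%:Z - k%:Z) ^+ (n - m - 1).
  by rewrite subzn ?(ltnW ltkn) // -[LHS]natz natrX natz.
ring.
Qed.

Lemma card_funs_onto_diff (n k : nat) :
  #|funs_onto n k|%:Z = iter k diff (fun y => y ^+ n) (n%:Z - k%:Z).
Proof.
have [kn|nk] := leqP k n; last first.
  (* For k > n the element n + 1 of [k] is never a value. *)
  rewrite iter_diff_expr_small //; congr (_%:Z); apply/eqP; rewrite cards_eq0.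
  apply/eqP/setP => f; rewrite !inE; apply/negP => /allP/(_ n.+1).
  rewrite mem_iota add1n !ltnS leq0n nk => /(_ isT)/mapP[x _ [nx]].
  by have := ltn_ord (f x); rewrite -nx ltnn.
pose K := [set i : 'I_n | (i < k)%N].
have cK : #|K| = k.
  rewrite -sum1dep_card (big_ord_narrow kn) /=; by rewrite sum1_card card_ord.
have := @card_ffuns_onto 'I_n 'I_n setT K (subsetT _).
rewrite cK cardsT card_ord => <-; congr (_%:Z); apply: eq_card => f; rewrite !in_set.
have -> : f \in ffun_on (mem [set: 'I_n]) by apply/ffun_onP => x; rewrite inE.
apply/allP/subsetP => [fK i|fK j].
  rewrite inE => ik; have /mapP[x _ [/val_inj ->]] : i.+1 \in [seq (f x).+1 | x : 'I_n].
    by apply: fK; rewrite mem_iota add1n ltnS.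
  by rewrite imset_f.
rewrite mem_iota add1n; case: j => // j /[!ltnS] jk.
have /imsetP[x _ jx] : Ordinal (leq_trans jk kn) \in f @: setT by apply: fK; rewrite inE.
by apply/mapP; exists x; rewrite ?mem_enum // -jx.
Qed.

Theorem theorem2p3 (n k : nat) :
  let lhs : nat :=
    (\sum_(k <= m < n.+1)
       'C(n.+1, m.+1) * stirling2 m.+1 k.+1 * k`! *
       (if m == n then 1 else (n - k) ^ (n - m - 1) * (m - k)))%N in
  let rhs : int :=
    \sum_(0 <= i < k.+1)
       (-1) ^+ i * ('C(k, i))%:Z * (n%:Z - i%:Z) ^+ n in
  [/\ #|trees_MD n k| = #|funs_onto n k|,
      #|trees_MD n k| = lhs,
      #|funs_onto n k|%:Z = rhs
    & lhs%:Z = rhs].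
Proof.
move=> lhs rhs.
have rhsE : rhs = iter k diff (fun y => y ^+ n) (n%:Z - k%:Z).
  by rewrite iter_diffE; apply: eq_bigr => i _; rewrite subrK.
have lhsE : lhs%:Z = rhs.
  rewrite rhsE; have [kn|nk] := leqP k n; first exact: stirling_sum_diff.
  by rewrite /lhs big_geq // iter_diff_expr_small.
have funsE : #|funs_onto n k|%:Z = rhs by rewrite card_funs_onto_diff.
have treesE : #|trees_MD n k| = lhs.
  rewrite card_trees_MD; have [kn|nk] := leqP k n.
    rewrite card_tree_funs_MDE //; apply: eq_big_nat => m /andP[km mn].
    rewrite /nb_forests; congr (_ * _)%N.
    (* The special case of [nb_forests] occurs exactly at m = n. *)
    have -> : (m - k == n - k)%N = (m == n) by lia.
    by case: eqP => // _; rewrite mulnC; congr (_ ^ _ * _)%N; lia.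
  rewrite /lhs big_geq //; apply/eqP; rewrite cards_eq0; apply/eqP/setP => T.
  rewrite !inE; apply/negP => /andP[_ /eqP cA].
  by have := max_card (increasing_ancestry T.2); rewrite cA card_ord leqNgt ltnS nk.
by split=> //; apply/eqP; rewrite -eqz_nat treesE lhsE funsE.
Qed.
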